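(* Let $\{f_1,\ldots,f_q\}$ be a set of injective contractions of a complete metric space. Assume that the associated attractor $T$ is connected and satisfies $\#(f_\alpha(T)\cap f_\beta(T))\neq 1$ for each pair of elements $\alpha,\beta\in\{1,2,\ldots,q\}^*$. Then either $T$ has a cut point or each irreducible cut set $X$ of $T$ is a perfect set.
   Context: The attractor of an iterated function system (IFS) $\{f_1,\ldots,f_q\}$ of injective contractions on a complete metric space is the unique nonempty compact set $T$ with $T=\bigcup_{i=1}^q f_i(T)$. $\{1,\ldots,q\}^*$ denotes the set of all nonempty finite words over $\{1,\ldots,q\}$; for a word $\alpha=i_1i_2\cdots i_n$ put $f_\alpha:=f_{i_1}\circ f_{i_2}\circ\cdots\circ f_{i_n}$. A cut set of a connected set $Y$ is a subset $X\subset Y$ such that $Y\setminus X$ is disconnected; a cut point of $Y$ is a point $x\in Y$ such that $\{x\}$ is a cut set of $Y$. A cut set $X$ of a connected set $Y$ is irreducible if $Y\setminus X_0$ is connected for every proper subset $X_0$ of $X$ which is closed in $Y$. A set $X$ is perfect if it equals its derived set $X'$ (the set of its limit points). ''Either ... or'' is understood inclusively (at least one alternative holds). *)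

(* Defs.v *)
From HB Require Import structures.
From mathcomp Require Import all_boot all_order all_algebra.
From mathcomp Require Import all_classical all_reals all_analysis.

Set Implicit Arguments.
Unset Strict Implicit.
Unset Printing Implicit Defensive.

Import Order.TTheory GRing.Theory Num.Theory.

Local Open Scope classical_set_scope.
Local Open Scope ring_scope.

#[short(type="completeMetricType")]
HB.structure Definition CompleteMetric (R : numDomainType) :=
  {M of Complete M & Metric R M}.

(* The library's [is_contraction] requires normed modules. *)
Definition metric_contraction (R : realType) (M : metricType R) (g : M -> M) :=
  exists2 k : R, 0 <= k < 1 & forall x y, mdist (g x) (g y) <= k * mdist x y.

(* Uniqueness of [T] is not part of the definition: it is a consequence when
   the maps are contractions of a complete metric space. *)
Definition attractor (M : topologicalType) (q : nat) (f : 'I_q -> M -> M)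
    (T : set M) :=
  [/\ T !=set0, compact T & T = \bigcup_i (f i @` T)].

(* f_(i_1 ... i_n) = f_(i_1) \o ... \o f_(i_n), the leftmost letter being
   applied last. *)
Definition word_map (M : Type) (I : Type) (f : I -> M -> M) (w : seq I) :
    M -> M :=
  foldr (fun i g => f i \o g) id w.

Definition cut_set (M : topologicalType) (Y X : set M) :=
  X `<=` Y /\ ~ connected (Y `\` X).

Definition cut_point (M : topologicalType) (Y : set M) (x : M) :=
  Y x /\ cut_set Y [set x].

Definition irreducible_cut_set (M : topologicalType) (Y X : set M) :=
  cut_set Y X /\
  forall X0 : set M, X0 `<` X -> closed (X0 : set (subspace Y)) ->
    connected (Y `\` X0).

(* Main.v *)
(** A cut [T \ X = U u V] by disjoint open sets forces an irreducible [X] to be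
    closed.  If [x] were isolated in [X], then for large [n] the pieces
    [f_w(T)], [|w| = n], containing [x] would be so small that [f_w(T) \ {x}]
    avoids [X]; these punctured pieces are connected because [T] has no cut
    point, and any two of them meet because no intersection of pieces is a
    singleton.  Hence all of them lie on the same side, say [U], so that [x] has
    a neighbourhood in [T] contained in [U u {x}], and then already [X \ {x}]
    cuts [T], contradicting irreducibility. *)

Require Import Defs.
From mathcomp Require Import all_boot all_order all_algebra.
From mathcomp Require Import all_classical all_reals all_analysis.

Local Open Scope classical_set_scope.
Local Open Scope card_scope.

Import Order.TTheory GRing.Theory Num.Theory.
Import numFieldNormedType.Exports.

(** * Separations by open sets and irreducible cut sets *)

Lemma open_disjoint_separated (M : topologicalType) (U V : set M) :
  open U -> open V -> U `&` V = set0 -> separated U V.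
Proof.
move=> oU oV UV; split; apply/eqP/negPn/negP => /set0P[x].
- move=> [/(_ V) clU Vx].
  by have /set0P/eqP := clU (open_nbhs_nbhs (conj oV Vx)).
- move=> [Ux /(_ U) clV].
  have /set0P/eqP := clV (open_nbhs_nbhs (conj oU Ux)).
  by rewrite setIC.
Qed.

Lemma open_cover_not_connected (M : topologicalType) (Y U V : set M) :
  open U -> open V -> Y `<=` U `|` V -> Y `&` (U `&` V) = set0 ->
  Y `&` U !=set0 -> Y `&` V !=set0 -> ~ connected Y.
Proof.
move=> oU oV YUV dUV YU [z [Yz Vz]] cY.
have YUY : Y `&` U = Y.
  apply: cY => //; first by exists U.
  exists (~` V); first exact: open_closedC.
  apply/seteqP; split => x [Yx].
    by move=> Ux; split => // Vx; rewrite -[False]/(set0 x) -dUV.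
  by move=> nVx; split => //; have [] := YUV _ Yx.
have [_ Uz] : (Y `&` U) z by rewrite YUY.
by rewrite -[False]/(set0 z) -dUV.
Qed.

(** Complete normality of metric spaces. *)
Lemma separated_open_nbhd (R : realType) (M : metricType R) (A B : set M) :
  separated A B -> exists U V : set M,
    [/\ open U, open V, U `&` V = set0, A `<=` U & B `<=` V].
Proof.
move=> sAB.
(* Balls around points of [A] whose radius is at most half the distance to [B]. If a ball of radius
   [r] around [a] met one of radius [s] around [b], then [mdist a b < r + s], although it is at
   least both [r + r] and [s + s]. *)
pose N (A B : set M) : set M := [set x | exists a r,
  [/\ A a, (mdist a x < r)%R & forall b, B b -> (r + r <= mdist a b)%R]].
have oN C D : open (N C D).
  rewrite openE => x [a [r [Ca axr rD]]].
  rewrite /interior -nbhs_ballE.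
  exists (r - mdist a x)%R; rewrite /= ?subr_gt0// ballEmdist => y /= xy.
  exists a, r; split => //; apply: le_lt_trans (metric_triangle _ x _) _.
  by rewrite -ltrBrDl.
have subN C D : closure D `&` C = set0 -> C `<=` N C D.
  move=> DC x Cx.
  have /existsNP[E] : ~ closure D x.
    by move=> Dx; rewrite -[False]/(set0 x) -DC.
  move=> /not_implyP[/nbhs_ballP[e /= e0 eE] /nonemptyPn DE].
  exists x, (e / 2)%R; split => //; first by rewrite mdistxx divr_gt0.
  move=> b Db; rewrite -splitr leNgt; apply/negP => xb.
  rewrite -[False]/(set0 b) -DE; split => //.
  by apply: eE; rewrite ballEmdist.
exists (N A B), (N B A); split => //.
- apply/seteqP; split => // x [[a [r [Aa ax rB]]] [b [s [Bb bx sA]]]].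
  have ab : (mdist a b < r + s)%R.
    apply: le_lt_trans (metric_triangle _ x _) _.
    by rewrite ltrD// metric_sym.
  have := rB _ Bb; have := sA _ Aa; rewrite (metric_sym b) => h1 h2.
  have := lerD h1 h2; rewrite leNgt => /negP; apply.
  by rewrite addrACA [(s + r)%R]addrC ltrD.
- by apply: subN; rewrite setIC; case: sAB.
- by apply: subN; case: sAB.
Qed.

(** Enlarge the two halves of [Y \ X] to disjoint open sets. What they leave uncovered in [Y] is
    contained in [X], closed in [Y], and still cuts [Y]; by irreducibility it cannot be smaller than
    [X]. *)
Lemma irreducible_cut_setE (R : realType) (M : metricType R) (Y X : set M) :
  irreducible_cut_set Y X -> exists U V : set M,
    [/\ open U, open V, U `&` V = set0, Y `&` U !=set0 & Y `&` V !=set0] /\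
    X = Y `\` (U `|` V).
Proof.
move=> [[XY /connectedPn[E [E0 YXE sE]]] irr].
have [U [V [oU oV UV EU EV]]] := separated_open_nbhd _ _ _ _ sE.
have EY b : E b `<=` Y.
  move=> x Ebx; have [] // : (Y `\` X) x.
  by rewrite YXE; case: b Ebx; [right|left].
have YU : Y `&` U !=set0.
  by have [x Ex] := E0 false; exists x; split; [exact: EY Ex|exact: EU].
have YV : Y `&` V !=set0.
  by have [x Ex] := E0 true; exists x; split; [exact: EY Ex|exact: EV].
exists U, V; split => //.
have sub : Y `\` (U `|` V) `<=` X.
  move=> x [Yx nUVx]; apply: contrapT => nXx; apply: nUVx.
  have : (Y `\` X) x by [].
  by rewrite YXE => -[/EU|/EV]; [left|right].
apply: contrapT => neq.
have : connected (Y `\` (Y `\` (U `|` V))).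
  apply: irr; first by rewrite properEneq; split => //; apply/eqP/nesym.
  apply/closed_subspaceP; exists (~` (U `|` V)).
    by apply: open_closedC; exact: openU.
  by rewrite setDE -setIA [~` _ `&` _]setIC setIA setIid setIC.
rewrite setDD; apply: (@open_cover_not_connected _ _ U V) => //.
- by rewrite UV setI0.
- by case: YU => x [Yx Ux]; exists x; split => //; split => //; left.
- by case: YV => x [Yx Vx]; exists x; split => //; split => //; right.
Qed.

(* Otherwise [x] could join the side [U], so that [X `\ x] would still cut [Y]. *)
Lemma irreducible_cut_set_two_sided (M : topologicalType) (Y U V : set M)
    (x : M) (W : set M) :
  let X := Y `\` (U `|` V) in
  irreducible_cut_set Y X -> closed Y -> open U -> open V -> U `&` V = set0 ->
  Y `&` U !=set0 -> Y `&` V !=set0 -> X x ->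
  closed (X `\ x) -> open W -> W x -> ~ (Y `&` W `<=` U `|` [set x]).
Proof.
move=> X [_ irr] cY oU oV UV YU YV Xx cX oW Wx YWU.
have : connected (Y `\` (X `\ x)).
  apply: irr; last exact: closed_subspaceW.
  split; first by move=> y [].
  by move=> /(_ _ Xx)[_]; exact.
(* Within [Y], passing from [U] to [U]|[W] adds at most the point [x], which is outside [V]. *)
apply: (@open_cover_not_connected _ _ (U `|` W) V) => //.
- exact: openU.
- move=> y [Yy nXy]; have [->|yx] := EM (y = x); first by left; right.
  apply: contrapT => nUV; apply: nXy; split => //; split => // UVy.
  by apply: nUV; case: UVy; [left; left|right].
- apply/seteqP; split => // y [[Yy _] [UWy Vy]].
  have {}UWy : (U `|` [set x]) y by case: UWy => [|Wy]; [left|exact: YWU].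
  case: UWy => [Uy|yx]; first by rewrite -UV.
  by case: Xx => _ []; right; rewrite -yx.
- case: YU => y [Yy Uy]; exists y; split; last by left.
  by split => // -[[_ []]]; left.
- case: YV => y [Yy Vy]; exists y; split => //.
  by split => // -[[_ []]]; right.
Qed.

(** * Bounds from compactness and from finiteness of the system *)

Lemma not_set1_other (S : Type) (A : set S) (x : S) :
  A x -> ~ (A #= `I_1) -> exists2 y, A y & y <> x.
Proof.
move=> Ax A1; apply: contrapT => noy; apply: A1.
suff -> : A = [set x] by exact: card_set1.
apply/seteqP; split => [y Ay|_ -> //].
by apply: contrapT => yx; apply: noy; exists y.
Qed.

Lemma compact_mdist_bounded (R : realType) (M : metricType R) (T : set M) :
  T !=set0 -> compact T ->
  exists D : R, forall x y, T x -> T y -> (mdist x y <= D)%R.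
Proof.
move=> T0 cT; case: (T0) => a Ta.
have ca : continuous (mdist a : M -> R).
  move=> x; apply/cvgrPdist_lt => e e0.
  near=> y.
  have xy : (mdist x y < e)%R.
    by near: y; exact: (metricType_numDomainType.cvgr_dist_lt cvg_id).
  have h1 := metric_triangle a x y; have h2 := metric_triangle a y x.
  apply: le_lt_trans xy; rewrite ler_norml lerNl opprB !lerBlDl h1.
  by rewrite (metric_sym x).
have [c cT' maxc] := compact_EVT_max T0 cT (continuous_subspaceT ca).
exists (mdist a c + mdist a c)%R => x y Tx Ty.
apply: le_trans (metric_triangle _ a _) _.
by rewrite lerD// ?[mdist x a]metric_sym; apply: maxc; rewrite inE.
Unshelve. all: by end_near.
Qed.

Lemma uniform_ratio (R : realType) (M : metricType R) (I : finType)
    (f : I -> M -> M) : (forall i, metric_contraction (f i)) ->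
  exists2 k : R, (0 <= k < 1)%R &
    forall i x y, (mdist (f i x) (f i y) <= k * mdist x y)%R.
Proof.
move=> fc.
have /choice[k kP] : forall i, exists k : R, (0 <= k < 1)%R /\
    forall x y, (mdist (f i x) (f i y) <= k * mdist x y)%R.
  by move=> i; have [k k01 fk] := fc i; exists k.
(* The default value 0 keeps the ratio in [0, 1) even when [I] is empty. *)
exists (\big[Num.max/0%R]_i k i).
  apply/andP; split; first exact: bigmax_ge_id.
  by apply/bigmax_ltP; split => // i _; case: (kP i) => /andP[].
move=> i x y; apply: le_trans (proj2 (kP i) x y) _.
by rewrite ler_wpM2r ?mdist_ge0// le_bigmax.
Qed.

(** * Compositions along words and the pieces of the attractor *)

Section WordMaps.
Context {R : realType} {M : metricType R} {q : nat} (f : 'I_q -> M -> M).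

Lemma word_map_inj (w : seq 'I_q) :
  (forall i, injective (f i)) -> injective (word_map f w).
Proof. by move=> fi; elim: w => //= i w IH x y /fi /IH. Qed.

Lemma word_map_lipschitz (k : R) (w : seq 'I_q) : (0 <= k)%R ->
  (forall i x y, (mdist (f i x) (f i y) <= k * mdist x y)%R) ->
  forall x y, (mdist (word_map f w x) (word_map f w y)
               <= k ^+ size w * mdist x y)%R.
Proof.
move=> k0 fk; elim: w => [|i w IH] x y /=; first by rewrite expr0 mul1r.
by rewrite exprS -mulrA (le_trans (fk _ _ _))// ler_wpM2l.
Qed.

Lemma lipschitz_continuous (g : M -> M) (k : R) : (0 <= k)%R ->
  (forall x y, (mdist (g x) (g y) <= k * mdist x y)%R) -> continuous g.
Proof.
move=> k0 gk x; apply/metricType_numDomainType.cvgrPdist_lt => e e0.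
near=> y.
(* Dividing by [k + 1] covers the case [k = 0]. *)
have xy : (mdist x y < e / (k + 1))%R.
  near: y; apply: (metricType_numDomainType.cvgr_dist_lt cvg_id).
  by rewrite divr_gt0// ltr_wpDl.
apply: le_lt_trans (gk _ _) _.
rewrite ltr_pdivlMr ?ltr_wpDl// in xy.
apply: le_lt_trans xy; rewrite mulrC ler_wpM2l ?mdist_ge0//.
by rewrite lerDl.
Unshelve. all: by end_near.
Qed.

Lemma word_map_sub {T : set M} (w : seq 'I_q) :
  T = \bigcup_i (f i @` T) -> word_map f w @` T `<=` T.
Proof.
move=> TE; elim: w => [|i w IH] x [y Ty <-] //=.
rewrite TE; exists i => //; exists (word_map f w y) => //.
by apply: IH; exists y.
Qed.

(** Each use of the self-similarity of [T] peels off one letter. Tuples are used because words of a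
    fixed length form a finite type, so these pieces give a finite cover. *)
Lemma word_map_cover {T : set M} (n : nat) (x : M) :
  T = \bigcup_i (f i @` T) -> T x ->
  exists w : n.-tuple 'I_q, (word_map f w @` T) x.
Proof.
move=> TE; elim: n x => [|n IH] x Tx; first by exists [tuple]; exists x.
move: (Tx); rewrite {1}TE => -[i _ [y Ty <-]].
have [w [z Tz <-]] := IH _ Ty.
by exists [tuple of i :: w]; exists z.
Qed.

End WordMaps.

(** * Absence of isolated points in irreducible cut sets *)

Theorem corollary2p2 (R : realType) (M : completeMetricType R) (q : nat)
    (f : 'I_q -> M -> M) (T : set M)
    (f_inj : forall i, injective (f i))
    (f_contr : forall i, metric_contraction (f i))
    (T_attr : attractor f T)
    (T_conn : connected T)
    (T_card : forall a b : seq 'I_q, a <> [::] -> b <> [::] ->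
       ~ ((word_map f a @` T) `&` (word_map f b @` T) #= `I_1)) :
  (exists x, cut_point T x) \/
  (forall X : set M, irreducible_cut_set T X -> limit_point X = X).
Proof.
case: T_attr => T0 cT TE.
have [|noCut] := EM (exists x, cut_point T x); [by left|right=> X irrX].
have clT : closed T by apply: compact_closed => //; exact: metric_hausdorff.
have [U [V [[oU oV UV YU YV] XE]]] := irreducible_cut_setE _ _ _ _ irrX.
have clX : closed X.
  by rewrite XE setDE; apply: closedI => //; apply: open_closedC; exact: openU.
apply/seteqP; split => [x /subset_limit_point|x Xx].
  by move/closure_id : clX => <-.
apply: contrapT => nlx.
have [e /= e0 eX] : exists2 e : R, (0 < e)%R & ball x e `&` X `<=` [set x].
  move/existsNP : nlx => [E /not_implyP[/nbhs_ballP[e /= e0 eE] nE]].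
  exists e => // y [/eE Ey Xy]; apply: contrapT => yx; apply: nE; exists y.
  by split => //; exact/eqP.
(* Removing the isolated point [x] from [X] amounts to removing an open neighbourhood of [x]. *)
have clXx : closed (X `\ x).
  rewrite (_ : X `\ x = X `&` ~` (ball x e)^°).
    by apply: closedI => //; apply: open_closedC; exact: open_interior.
  apply/seteqP; split => y [Xy yx]; split => //.
    by move=> /interior_subset xy; apply: yx; exact: eX.
  by move=> yx'; apply: yx; rewrite yx'; exact: nbhsx_ballx.
have Tx : T x by move: Xx; rewrite XE => -[].
have [k /andP[k0 k1] fk] := uniform_ratio _ _ _ _ f_contr.
have [D TD] := compact_mdist_bounded _ _ _ T0 cT.
have D0 : (0 <= D)%R by apply: le_trans (TD _ _ Tx Tx); exact: mdist_ge0.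
(* The length is [n.+1] because the hypothesis on intersections concerns nonempty words only;
   [D + 1] avoids dividing by zero when [T] is a single point. *)
have [n nD] : exists n, (k ^+ n.+1 * D < e)%R.
  have /cvg_expr/cvgrPdist_lt/(_ (e / (D + 1))%R) : (`|k| < 1)%R.
    by rewrite ger0_norm.
  rewrite divr_gt0// ?ltr_wpDl// => /(_ isT)[n _ /(_ n.+1)].
  move=> /(_ (leqnSn _)); rewrite /= sub0r normrN ger0_norm ?exprn_ge0// => kn.
  exists n; rewrite ltr_pdivlMr ?ltr_wpDl// in kn; apply: le_lt_trans kn.
  by rewrite ler_wpM2l ?exprn_ge0// lerDl.
pose F (w : n.+1.-tuple 'I_q) := word_map f w @` T.
have ctsw (w : seq 'I_q) : continuous (word_map f w).
  apply: (lipschitz_continuous _ (k ^+ size w)); first exact: exprn_ge0.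
  exact: word_map_lipschitz.
have clF w : closed (F w).
  apply: compact_closed; first exact: metric_hausdorff.
  by apply: continuous_compact => //; exact: continuous_subspaceT.
have w0 (w : n.+1.-tuple 'I_q) : tval w <> [::].
  by move=> /(congr1 size); rewrite size_tuple.
(* A piece through [x] has diameter less than [e], so it stays in the ball that meets [X] only at
   [x]. *)
have sideF w : F w x -> F w `\ x `<=` U `|` V.
  move=> Fwx y [Fwy yx]; apply: contrapT => nUV; apply: yx; apply: eX.
  split; last first.
    by rewrite XE; split => //; exact: word_map_sub TE _ Fwy.
  rewrite ballEmdist/=; case: Fwx Fwy => [a Ta <-] [b Tb <-].
  apply: le_lt_trans (word_map_lipschitz _ k _ k0 fk _ _) _.
  apply: le_lt_trans nD; rewrite size_tuple ler_wpM2l ?exprn_ge0//.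
  exact: TD.
(* By injectivity the punctured piece is the image of [T] without the preimage [a] of [x], and [a]
   is not a cut point. *)
have connF w : F w x -> connected (F w `\ x).
  move=> [a Ta ax].
  have -> : F w `\ x = word_map f w @` (T `\ a).
    apply/seteqP; split => y.
      move=> [[b Tb <-] bx]; exists b => //; split => // ba.
      by apply: bx; rewrite /= ba.
    move=> [b [Tb ba] <-]; split; first by exists b.
    by rewrite /= -ax => /word_map_inj; move=> /(_ f_inj)/ba.
  apply: connected_continuous_connected; last exact: continuous_subspaceT.
  apply: contrapT => ncon; apply: noCut; exists a; split => //; split => //.
  by move=> b ->.
have meetF w v : F w x -> F v x -> exists2 y, (F w `&` F v) y & y <> x.
  move=> Fwx Fvx; apply: not_set1_other; first by split.
  exact: T_card.
have connFF w v : F w x -> F v x -> connected ((F w `\ x) `|` (F v `\ x)).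
  move=> Fwx Fvx; apply: connectedU; [|exact: connF|exact: connF].
  have [y [Fwy Fvy] yx] := meetF _ _ Fwx Fvx.
  by exists y; split.
(* Discarding the finitely many closed pieces that miss [x] leaves an open neighbourhood of [x] on
   which [T] is covered by the pieces through [x]. *)
pose W := ~` \bigcup_(w in [set w | ~ F w x]) F w.
have oW : open W.
  apply: closed_openC; apply: closed_bigcup => [|w _]; last exact: clF.
  exact: finite_finset.
have Wx : W x by move=> [w].
have TW y : T y -> W y -> exists2 w, F w x & F w y.
  move=> Ty Wy; have [w Fwy] := word_map_cover f n.+1 _ TE Ty.
  by exists w => //; apply: contrapT => nFx; apply: Wy; exists w.
have [w Fwx] := word_map_cover f n.+1 _ TE Tx.
have UVsep := open_disjoint_separated _ _ _ oU oV UV.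
(* Intersecting the piece [F w] with itself yields a second point [z] in it; the side containing [z]
   decides the side of every punctured piece through [x]. *)
have [z [Fwz _] zx] := meetF _ _ Fwx Fwx.
have FUV v : F v x -> (F w `\ x) `|` (F v `\ x) `<=` U \/
    (F w `\ x) `|` (F v `\ x) `<=` V.
  move=> Fvx; apply: connected_subset => //; last exact: connFF.
  by rewrite subUset; split; exact: sideF.
have [Uz|Vz] : (U `|` V) z by apply: (sideF w Fwx).
- apply: (irreducible_cut_set_two_sided _ T U V x W) => //; rewrite -?XE//.
  move=> y [Ty Wy]; have [v Fvx Fvy] := TW _ Ty Wy.
  have [->|yx] := EM (y = x); first by right.
  left; case: (FUV _ Fvx) => sub; first by apply: sub; right.
  by exfalso; rewrite -[False]/(set0 z) -UV; split => //; apply: sub; left.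
- apply: (irreducible_cut_set_two_sided _ T V U x W) => //.
  + by rewrite setUC -XE.
  + by rewrite setIC.
  + by rewrite setUC -XE.
  + by rewrite setUC -XE.
  move=> y [Ty Wy]; have [v Fvx Fvy] := TW _ Ty Wy.
  have [->|yx] := EM (y = x); first by right.
  left; case: (FUV _ Fvx) => sub; last by apply: sub; right.
  by exfalso; rewrite -[False]/(set0 z) -UV; split => //; apply: sub; left.
Qed.
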